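(* The functors $\mathcal{M}:\mathbf{CSRng}\to\mathbf{ACMnd}$, $S\mapsto M_S$, and $\mathcal{E}:\mathbf{ACMnd}\to\mathbf{CSRng}$, $T\mapsto T(1)$, restrict to a pair of functors $\mathcal{M}:\mathbf{ICSRng}\to\mathbf{IACMnd}$ and $\mathcal{E}:\mathbf{IACMnd}\to\mathbf{ICSRng}$. The restricted functors form an adjunction $\mathcal{M}\dashv\mathcal{E}$.
   Context: $\mathbf{CSRng}$: commutative semirings in sets. $\mathbf{ICSRng}$: involutive commutative semirings, i.e. commutative semirings $S$ with a unary operation $*$ such that $(s+t)^*=s^*+t^*$, $0^*=0$, $(s\cdot t)^*=s^*\cdot t^*$, $1^*=1$, $(s^* )^*=s$; morphisms preserve all structure. $\mathbf{ACMnd}$: monads on $\mathbf{Sets}$ that are additive and commutative, with monad maps. Each monad $T$ on $\mathbf{Sets}$ has strength $\mathsf{st}:T(X)\times Y\to T(X\times Y)$, $\mathsf{st}(u,y)=T(\lambda x.(x,y))(u)$; let $\mathsf{st}'=T(\gamma)\circ\mathsf{st}\circ\gamma$ with $\gamma$ the swap. $T$ is commutative if $\mu\circ T(\mathsf{st}')\circ\mathsf{st}=\mu\circ T(\mathsf{st})\circ\mathsf{st}'$. If $T(0)\cong1$, let $0_{X,Y}=(X\to1\cong T(0)\xrightarrow{T(!)}T(Y))$, $p_1=[\eta,0_{Y,X}]$, $p_2=[0_{X,Y},\eta]$, $\mathsf{bc}=\langle\mu\circ T(p_1),\mu\circ T(p_2)\rangle:T(X+Y)\to T(X)\times T(Y)$.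 $T$ is additive if $T(0)\cong1$ and all $\mathsf{bc}$ are isomorphisms. $\mathbf{IACMnd}$: pairs $(T,\zeta)$ with $T\in\mathbf{ACMnd}$ and $\zeta:T\to T$ a monad map with $\zeta\circ\zeta=\mathrm{id}$; morphisms $(T,\zeta)\to(T',\zeta')$ are monad maps $\sigma:T\to T'$ with $\sigma\circ\zeta=\zeta'\circ\sigma$. Functor $\mathcal{M}$: $M_S(X)=\{\varphi:X\to S\mid\varphi\text{ has finite support}\}$, elements written as formal sums $\sum_is_ix_i$; $M_S(f)(\sum_is_ix_i)=\sum_is_if(x_i)$; unit $x\mapsto1x$; multiplication $\sum_is_i\varphi_i\mapsto\lambda x.\sum_is_i\varphi_i(x)$; a semiring map $f$ acts by $\sum_is_ix_i\mapsto\sum_if(s_i)x_i$. If $S$ has involution $*$, $M_S$ carries the involution $\zeta_X(\sum_is_ix_i)=\sum_is_i^*x_i$. Functor $\mathcal{E}$: $T(1)$ is a commutative semiring with addition $T(\nabla)\circ\mathsf{bc}^{-1}$ (where $\nabla=[\mathrm{id},\mathrm{id}]$), zero $0_{1,1}$, multiplication $\mu\circ T(\pi_2)\circ\mathsf{st}:T(1)\times T(1)\to T(1)$, unit $\eta_1$; a monad map $\sigma$ is sent to $\sigma_1$. For $(T,\zeta)\in\mathbf{IACMnd}$, $T(1)$ carries the involution $\zeta_1$. *)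

(* Defs.v *)
(* MathComp with the classical layer of MathComp-Analysis.  The category of sets
   is [Type] with functions; functional extensionality and proof irrelevance
   make equality of maps, monad maps, etc. extensional. *)
From HB Require Import structures.
From mathcomp Require Import all_boot all_order all_algebra.
From mathcomp Require Import boolp classical_sets functions cardinality fsbigop.
Set Implicit Arguments.
Unset Strict Implicit.
Unset Printing Implicit Defensive.
Import GRing.Theory.
Local Open Scope classical_set_scope.
Local Open Scope ring_scope.

Record category := Category {
  obj :> Type;
  hom : obj -> obj -> Type;
  idm : forall a, hom a a;
  cmp : forall a b c, hom b c -> hom a b -> hom a c;
  cmp1m : forall a b (f : hom a b), cmp (idm b) f = f;
  cmpm1 : forall a b (f : hom a b), cmp f (idm a) = f;
  cmpA : forall a b c d (h : hom c d) (g : hom b c) (f : hom a b),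
    cmp h (cmp g f) = cmp (cmp h g) f }.

Arguments hom {c} a b : rename.
Arguments idm {c} a : rename.
Arguments cmp {c a b c0} _ _ : rename.

Record functor (C D : category) := Functor {
  fobj :> C -> D;
  farr : forall a b : C, hom a b -> hom (fobj a) (fobj b);
  farr_id : forall a : C, farr (idm a) = idm (fobj a);
  farr_comp : forall (a b c : C) (g : hom b c) (f : hom a b),
    farr (cmp g f) = cmp (farr g) (farr f) }.

Arguments farr {C D} f {a b} _ : rename.

Section FunctorComp.
Variables (C D E : category) (G : functor D E) (F : functor C D).

Lemma fcomp_id (a : C) : farr G (farr F (idm a)) = idm (G (F a)).
Proof. by rewrite !farr_id. Qed.

Lemma fcomp_comp (a b c : C) (g : hom b c) (f : hom a b) :
  farr G (farr F (cmp g f)) = cmp (farr G (farr F g)) (farr G (farr F f)).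
Proof. by rewrite !farr_comp. Qed.

Definition fcomp : functor C E :=
  @Functor C E (fun a => G (F a)) (fun a b f => farr G (farr F f))
    fcomp_id fcomp_comp.
End FunctorComp.

Definition adjoint (C D : category) (L : functor C D) (R : functor D C) : Prop :=
  exists Phi : forall (c : C) (d : D), hom (L c) d -> hom c (R d),
    (forall c d, bijective (Phi c d)) /\
    (forall (c' c : C) (d d' : D) (f : hom c' c) (g : hom (L c) d) (h : hom d d'),
      Phi c' d' (cmp h (cmp g (farr L f))) =
      cmp (farr R h) (cmp (Phi c d g) f)).

Record monad := Monad {
  mcar :> Type -> Type;
  fmap : forall X Y : Type, (X -> Y) -> mcar X -> mcar Y;
  eta : forall X : Type, X -> mcar X;
  mu : forall X : Type, mcar (mcar X) -> mcar X;
  fmap_id : forall X (u : mcar X), fmap id u = u;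
  fmap_comp : forall X Y Z (g : Y -> Z) (f : X -> Y) (u : mcar X),
    fmap (g \o f) u = fmap g (fmap f u);
  eta_nat : forall X Y (f : X -> Y) x, fmap f (eta x) = eta (f x);
  mu_nat : forall X Y (f : X -> Y) (u : mcar (mcar X)),
    fmap f (mu u) = mu (fmap (fmap f) u);
  mu_eta : forall X (u : mcar X), mu (eta u) = u;
  mu_fmap_eta : forall X (u : mcar X), mu (fmap (@eta X) u) = u;
  mu_mu : forall X (u : mcar (mcar (mcar X))), mu (mu u) = mu (fmap (@mu X) u) }.

Arguments fmap m {X Y} f u : rename.
Arguments eta m {X} x : rename.
Arguments mu m {X} u : rename.

Record is_monad_map (T T' : monad) (s : forall X, T X -> T' X) : Prop := {
  mm_nat : forall X Y (f : X -> Y) (u : T X), s Y (fmap T f u) = fmap T' f (s X u);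
  mm_eta : forall X (x : X), s X (eta T x) = eta T' x;
  mm_mu : forall X (u : T (T X)), s X (mu T u) = mu T' (s (T' X) (fmap T (s X) u)) }.

Record monad_map (T T' : monad) := MonadMap {
  mm_fun :> forall X, T X -> T' X;
  mm_prop : is_monad_map mm_fun }.

Lemma monad_map_eq (T T' : monad) (s t : monad_map T T') :
  (forall X u, s X u = t X u) -> s = t.
Proof.
case: s t => [s ps] [t pt] /= st.
have E : s = t by apply: functional_extensionality_dep => X; apply/funext => u.
by subst t; congr MonadMap; exact: Prop_irrelevance.
Qed.

Lemma mm_id_prop (T : monad) : @is_monad_map T T (fun X u => u).
Proof.
split=> // X u; congr (mu T _); symmetry; exact: fmap_id.
Qed.
Definition mm_id (T : monad) : monad_map T T := MonadMap (mm_id_prop T).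

Lemma mm_comp_prop (T1 T2 T3 : monad) (t : monad_map T2 T3) (s : monad_map T1 T2) :
  is_monad_map (fun X u => t X (s X u)).
Proof.
case: s => s [sn se sm]; case: t => t [tn te tm] /=.
split=> [X Y f u|X x|X u]; first by rewrite sn tn.
  by rewrite se te.
rewrite sm tm; congr (mu T3 _).
have -> : (fun u => t X (s X u)) = t X \o s X by [].
by rewrite fmap_comp !sn.
Qed.
Definition mm_comp (T1 T2 T3 : monad) (t : monad_map T2 T3) (s : monad_map T1 T2) :
  monad_map T1 T3 := MonadMap (mm_comp_prop t s).

Lemma bij_inv_ex (A B : Type) (f : A -> B) : bijective f ->
  exists g : B -> A, cancel f g /\ cancel g f.
Proof. by case=> g fK gK; exists g. Qed.

Definition bij_inv (A B : Type) (f : A -> B) (h : bijective f) : B -> A :=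
  sval (cid (bij_inv_ex h)).

Lemma bij_invK A B (f : A -> B) (h : bijective f) : cancel f (bij_inv h).
Proof. by rewrite /bij_inv; case: cid => g []. Qed.
Lemma bij_invKV A B (f : A -> B) (h : bijective f) : cancel (bij_inv h) f.
Proof. by rewrite /bij_inv; case: cid => g []. Qed.

Section MonadOps.
Variable T : monad.

Definition swap (X Y : Type) (p : X * Y) : Y * X := (p.2, p.1).

Definition st (X Y : Type) (p : T X * Y) : T (X * Y)%type :=
  fmap T (fun x => (x, p.2)) p.1.

Definition st' (X Y : Type) (p : X * T Y) : T (X * Y)%type :=
  fmap T (@swap Y X) (st (swap p)).

Definition commutative_monad : Prop :=
  forall (X Y : Type) (p : T X * T Y),
    mu T (fmap T (@st' X Y) (st p)) = mu T (fmap T (@st X Y) (st' p)).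

(* T(0) is isomorphic to 1: the only map T(0) -> 1 is invertible *)
Definition affine0 : Prop := bijective (fun _ : T void => tt).

Section Bicartesian.
Variable h : affine0.

Definition zero_map (X Y : Type) (x : X) : T Y :=
  fmap T (@of_void Y) (bij_inv h tt).
Definition proj1_map (X Y : Type) (z : X + Y) : T X :=
  match z with inl x => eta T x | inr y => zero_map X y end.
Definition proj2_map (X Y : Type) (z : X + Y) : T Y :=
  match z with inl x => zero_map Y x | inr y => eta T y end.
Definition bc (X Y : Type) (u : T (X + Y)%type) : T X * T Y :=
  (mu T (fmap T (@proj1_map X Y) u), mu T (fmap T (@proj2_map X Y) u)).
End Bicartesian.

Record additive_monad : Prop := {
  add_affine0 : affine0;
  add_bc : forall X Y : Type, bijective (@bc add_affine0 X Y) }.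

Definition codiag (X : Type) (z : X + X) : X :=
  match z with inl x => x | inr x => x end.

Definition zero1 (a : additive_monad) : T unit :=
  zero_map (add_affine0 a) unit tt.
Definition add1 (a : additive_monad) (u v : T unit) : T unit :=
  fmap T (@codiag unit) (bij_inv (add_bc a unit unit) (u, v)).
Definition mul1 (u v : T unit) : T unit := mu T (fmap T snd (st (u, v))).
End MonadOps.

Record acmnd := ACMnd {
  acm_monad :> monad;
  acm_additive : additive_monad acm_monad;
  acm_commutative : commutative_monad acm_monad }.

Definition ACMND : category.
refine (@Category acmnd (fun T T' => monad_map T T') (fun T => mm_id T)
  (fun T1 T2 T3 t s => mm_comp t s) _ _ _).
- by move=> T T' s; exact: monad_map_eq.
- by move=> T T' s; exact: monad_map_eq.
- by move=> T1 T2 T3 T4 u t s; exact: monad_map_eq.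
Defined.

Section Bind.
Variable T : monad.
Definition bind X Y (k : X -> T Y) (u : T X) : T Y := mu T (fmap T k u).

Lemma bind_eta X Y (k : X -> T Y) x : bind k (eta T x) = k x.
Proof. by rewrite /bind eta_nat mu_eta. Qed.
Lemma bind_etar X (u : T X) : bind (@eta T X) u = u.
Proof. exact: mu_fmap_eta. Qed.
Lemma bind_fmap X Y Z (k : Y -> T Z) (f : X -> Y) u :
  bind k (fmap T f u) = bind (k \o f) u.
Proof. by rewrite /bind fmap_comp. Qed.
Lemma fmap_bind X Y Z (f : Y -> Z) (k : X -> T Y) u :
  fmap T f (bind k u) = bind (fmap T f \o k) u.
Proof. by rewrite /bind mu_nat fmap_comp. Qed.
Lemma fmapE X Y (f : X -> Y) u : fmap T f u = bind (fun x => eta T (f x)) u.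
Proof.
have -> : (fun x => eta T (f x)) = @eta T Y \o f by [].
by rewrite -bind_fmap bind_etar.
Qed.
Lemma bindA X Y Z (k : X -> T Y) (l : Y -> T Z) u :
  bind l (bind k u) = bind (fun x => bind l (k x)) u.
Proof.
rewrite /bind mu_nat mu_mu -!fmap_comp.
by congr (mu T (fmap T _ u)).
Qed.
Lemma eq_bind X Y (k l : X -> T Y) u : k =1 l -> bind k u = bind l u.
Proof. by move=> /funext ->. Qed.
End Bind.

Section Scalars.
Variables (T : monad) (a : additive_monad T).
Let h := add_affine0 a.

Lemma affine0_eq (u v : T void) : u = v.
Proof. by apply: (bij_inj h). Qed.

Definition zeroT X : T X := zero_map h X tt.
Lemma zero_mapE X Y (x : X) : zero_map h Y x = zeroT Y. Proof. by []. Qed.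

Lemma bind_zero X Y (k : X -> T Y) : bind k (zeroT X) = zeroT Y.
Proof.
by rewrite /zeroT /zero_map bind_fmap fmapE; apply: eq_bind; case.
Qed.

Lemma bind_0 X Y (u : T X) : bind (fun _ => zeroT Y) u = zeroT Y.
Proof.
rewrite /zeroT /zero_map.
have -> : (fun _ : X => fmap T (@of_void Y) (bij_inv h tt)) =
  fmap T (@of_void Y) \o (fun=> bij_inv h tt) by [].
by rewrite -fmap_bind; congr (fmap T _ _); exact: affine0_eq.
Qed.

Definition addT X (u v : T X) : T X :=
  fmap T (@codiag X) (bij_inv (add_bc a X X) (u, v)).

Lemma bcE X Y (u : T (X + Y)%type) :
  bc h u = (bind (@proj1_map T h X Y) u, bind (@proj2_map T h X Y) u).
Proof. by []. Qed.

Lemma addTE X (w : T (X + X)%type) u v : bc h w = (u, v) ->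
  addT u v = fmap T (@codiag X) w.
Proof. by move=> e; rewrite /addT -e bij_invK. Qed.

Lemma bc_ex X Y (u : T X) (v : T Y) : exists w, bc h w = (u, v).
Proof. by exists (bij_inv (add_bc a X Y) (u, v)); rewrite bij_invKV. Qed.

Lemma bc_fmap X Y X' Y' (f : X -> X') (g : Y -> Y') w u v :
  bc h w = (u, v) ->
  bc h (fmap T (fun z => match z with inl x => inl (f x) | inr y => inr (g y) end) w)
   = (fmap T f u, fmap T g v).
Proof.
rewrite !bcE => -[<- <-]; rewrite !bind_fmap !fmap_bind.
by congr pair; apply: eq_bind => -[x|y] /=; rewrite ?eta_nat // !zero_mapE
  ?fmapE bind_zero.
Qed.

Lemma bind_add X Y (k : X -> T Y) u v :
  bind k (addT u v) = addT (bind k u) (bind k v).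
Proof.
have [w ew] := bc_ex u v; rewrite (addTE ew) bind_fmap.
pose K (z : X + X) : T (Y + Y)%type :=
  match z with inl x => fmap T inl (k x) | inr x => fmap T inr (k x) end.
have e : bc h (bind K w) = (bind k u, bind k v).
  move: ew; rewrite !bcE => -[<- <-]; rewrite !bindA.
  congr pair; apply: eq_bind => -[x|x] /=; rewrite bind_fmap ?bind_eta ?bind_zero //;
  by (exact: bind_etar || exact: bind_0).
rewrite (addTE e) fmap_bind; apply: eq_bind => -[x|x] /=;
by rewrite -fmap_comp; symmetry; exact: fmap_id.
Qed.

Lemma addTC X : commutative (@addT X).
Proof.
move=> u v; have [w ew] := bc_ex u v; rewrite (addTE ew).
pose s (z : X + X) : X + X := match z with inl x => inr x | inr x => inl x end.
rewrite (@addTE _ (fmap T s w)).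
  by rewrite -fmap_comp; congr (fmap T _ w); apply/funext; case.
move: ew; rewrite !bcE => -[<- <-]; rewrite !bind_fmap.
by congr pair; apply: eq_bind => -[].
Qed.

Lemma addT0 X : right_id (zeroT X) (@addT X).
Proof.
move=> u; rewrite (@addTE _ (fmap T inl u)).
  by rewrite -fmap_comp; exact: fmap_id.
rewrite bcE !bind_fmap; congr pair; first exact: bind_etar.
exact: bind_0.
Qed.

Lemma addTA X : associative (@addT X).
Proof.
move=> u v t.
have [w ew] := bc_ex u v; have [r er] := bc_ex w t.
rewrite (addTE ew).
have e1 := bc_fmap (@codiag X) id er; rewrite (fmap_id t) in e1.
rewrite (addTE e1) -fmap_comp.
pose al (z : (X + X) + X) : X + X :=
  match z with inl (inl x) => inl x | inl (inr x) => inr x | inr x => inr x end.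
rewrite (@addTE _ (fmap T al r)).
  by rewrite -fmap_comp; congr (fmap T _ r); apply/funext => -[[]|].
move: ew er; rewrite !bcE => -[<- <-] [<- <-]; rewrite bind_fmap bindA.
congr pair.
  by apply: eq_bind => -[[x|x]|x] /=; rewrite ?bind_eta // zero_mapE bind_zero.
pose be (z : (X + X) + X) : T (X + X)%type :=
  match z with inl (inl x) => zeroT _ | inl (inr x) => eta T (inl x)
             | inr x => eta T (inr x) end.
rewrite bind_fmap (@addTE _ (bind be r)).
  rewrite fmap_bind; apply: eq_bind => -[[x|x]|x] /=;
    rewrite ?zero_mapE ?eta_nat //; by rewrite fmapE bind_zero.
rewrite bcE !bindA; congr pair; apply: eq_bind => -[[x|x]|x] /=;
  by rewrite ?zero_mapE ?bind_eta ?bind_zero.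
Qed.

Lemma mul1E (u v : T unit) : mul1 u v = bind (fun _ => v) u.
Proof.
rewrite /mul1 /st -[mu _ _]/(bind _ _) bind_fmap //=.
Qed.

End Scalars.

Section MonadMapScalars.
Variables (T T' : monad) (a : additive_monad T) (a' : additive_monad T').
Variable s : monad_map T T'.

Lemma mm_bind X Y (k : X -> T Y) u : s Y (bind k u) = bind (fun x => s Y (k x)) (s X u).
Proof.
case: s => f [fn fe fm] /=; rewrite /bind fm -[in RHS]fn; congr (mu T' (f _ _)).
by rewrite -fmap_comp.
Qed.

Lemma mm_zeroT X : s X (zeroT a X) = zeroT a' X.
Proof.
rewrite /zeroT /zero_map (mm_nat (mm_prop s)); congr (fmap T' _ _).
exact: affine0_eq.
Qed.

Lemma mm_addT X u v : s X (addT a u v) = addT a' (s X u) (s X v).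
Proof.
have [w ew] := bc_ex a u v; rewrite (addTE ew) (mm_nat (mm_prop s)).
symmetry; apply: addTE.
move: ew; rewrite !bcE => -[<- <-]; rewrite !mm_bind.
by congr pair; apply: eq_bind => -[x|x] /=;
  rewrite ?(mm_eta (mm_prop s)) // zero_mapE; symmetry; exact: mm_zeroT.
Qed.

Lemma mm_mul1 u v : s unit (mul1 u v) = mul1 (s unit u) (s unit v).
Proof. by rewrite !mul1E mm_bind. Qed.
End MonadMapScalars.

Lemma rmorph_eq (R S : comPzSemiRingType) (f g : {rmorphism R -> S}) :
  f =1 g -> f = g.
Proof.
case: f g => f [[pf] [qf]] [g [[pg] [qg]]] /= /funext fg; subst g.
congr (GRing.RMorphism.Pack (GRing.RMorphism.Class _ _)).
- by congr Algebra.isNmodMorphism.Axioms_; exact: Prop_irrelevance.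
- by congr GRing.isMonoidMorphism.Axioms_; exact: Prop_irrelevance.
Qed.

(* [comPzSemiRingType] allows 0 = 1.  It also packages a choice structure on
   the carrier; morphisms ignore it and, classically, every type has one, so
   the category below is equivalent to that of bare commutative semirings. *)
Definition CSRNG : category.
refine (@Category comPzSemiRingType (fun R S => {rmorphism R -> S})
  (fun R => [the {rmorphism R -> R} of idfun])
  (fun R S U g f => [the {rmorphism R -> U} of g \o f]) _ _ _).
- by move=> R S f; exact: rmorph_eq.
- by move=> R S f; exact: rmorph_eq.
- by move=> R S U V h g f; exact: rmorph_eq.
Defined.

Definition scal (T : acmnd) : Type := T unit.
HB.instance Definition _ (T : acmnd) := gen_eqMixin (scal T).
HB.instance Definition _ (T : acmnd) := gen_choiceMixin (scal T).

Section ScalSemiring.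
Variable T : acmnd.
Let a := acm_additive T.
Let addS : scal T -> scal T -> scal T := add1 a.
Let mulS : scal T -> scal T -> scal T := @mul1 T.

Lemma scal_addA : associative addS. Proof. exact: addTA. Qed.
Lemma scal_addC : commutative addS. Proof. exact: addTC. Qed.
Lemma scal_add0 : left_id (zero1 a : scal T) addS.
Proof. by move=> x; rewrite scal_addC; exact: addT0. Qed.

HB.instance Definition _ := GRing.isNmodule.Build (scal T)
  scal_addA scal_addC scal_add0.

Lemma scal_mulA : associative mulS.
Proof. by move=> x y z; rewrite /mulS !mul1E bindA. Qed.

Lemma fmap_unit (f : unit -> unit) (u : T unit) : fmap T f u = u.
Proof.
by rewrite -[RHS](fmap_id u); congr (fmap T _ u); apply/funext; case; case: (f tt).
Qed.

Lemma scal_mulC : commutative mulS.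
Proof.
move=> u v; rewrite /mulS !mul1E.
have := acm_commutative (u, v); rewrite /st' /st /swap /=.
rewrite -![mu _ (fmap _ _ _)]/(bind _ _) -!fmap_comp !bind_fmap.
move=> /(congr1 (fmap T (fun=> tt))); rewrite !fmap_bind.
rewrite [X in X = _ -> _](eq_bind (l := fun=> v)); last first.
  by move=> [] /=; rewrite -!fmap_comp; exact: fmap_unit.
rewrite [X in _ = X -> _](eq_bind (l := fun=> u)); last first.
  by move=> [] /=; rewrite -!fmap_comp; exact: fmap_unit.
by [].
Qed.

Lemma scal_mul1 : left_id (eta T tt : scal T) mulS.
Proof. by move=> x; rewrite /mulS mul1E bind_eta. Qed.

Lemma scal_mulDl : left_distributive mulS addS.
Proof. by move=> x y z; rewrite /mulS !mul1E; exact: bind_add. Qed.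

Lemma scal_mul0 : left_zero (zero1 a : scal T) mulS.
Proof. by move=> x; rewrite /mulS mul1E; exact: bind_zero. Qed.

HB.instance Definition _ := GRing.Nmodule_isComPzSemiRing.Build (scal T)
  scal_mulA scal_mulC scal_mul1 scal_mulDl scal_mul0.
End ScalSemiring.

Section ScalMorphism.
Variables (T T' : acmnd) (s : monad_map T T').
Definition scal_map (u : scal T) : scal T' := s unit u.

Lemma scal_map_add : nmod_morphism scal_map.
Proof. by split=> [|x y]; [exact: mm_zeroT|exact: mm_addT]. Qed.
Lemma scal_map_mul : monoid_morphism scal_map.
Proof. by split=> [|x y]; [exact: (mm_eta (mm_prop s))|exact: mm_mul1]. Qed.

HB.instance Definition _ := GRing.isNmodMorphism.Build (scal T) (scal T') scal_map
  scal_map_add.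
HB.instance Definition _ := GRing.isMonoidMorphism.Build (scal T) (scal T') scal_map
  scal_map_mul.
End ScalMorphism.

Definition E0 : functor ACMND CSRNG.
refine (@Functor ACMND CSRNG (fun T : acmnd => scal T : comPzSemiRingType)
  (fun T T' s => [the {rmorphism scal T -> scal T'} of scal_map s]) _ _).
- by move=> T; exact: rmorph_eq.
- by move=> T1 T2 T3 t s; exact: rmorph_eq.
Defined.

Record fsmap (S : comPzSemiRingType) (X : Type) := FSMap {
  fs_fun :> X -> S;
  fs_fin : finite_set [set x | fs_fun x != 0] }.

Lemma fsmap_eq (S : comPzSemiRingType) X (p q : fsmap S X) : p =1 q -> p = q.
Proof.
case: p q => p pf [q qf] /= /funext pq; subst q.
by congr FSMap; exact: Prop_irrelevance.
Qed.

Lemma fs_finite (S : comPzSemiRingType) X (p : X -> S) (s : seq {classic X}) :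
  (forall x, p x != 0 -> (x : {classic X}) \in s) -> finite_set [set x | p x != 0].
Proof.
move=> h; apply: (@sub_finite_set {classic X} _ [set` s]); last exact: finite_seq.
by move=> x /= /h.
Qed.

Lemma fs_enum (S : comPzSemiRingType) X (p : fsmap S X) :
  exists2 s : seq {classic X}, uniq s &
    forall x, p x != 0 -> (x : {classic X}) \in s.
Proof.
have /(@finite_seqP {classic X})[s es] := fs_fin p.
exists (undup s); first exact: undup_uniq.
move=> x px; rewrite mem_undup.
have : [set x : {classic X} | p x != 0] x by [].
by rewrite es.
Qed.

Section Multiset.
Variable S : comPzSemiRingType.
Implicit Types X Y Z : Type.

(* Finite sums over arbitrary types are taken over their classical choice
   structure [{classic X}]. *)
Definition ms_map_fun X Y (f : X -> Y) (p : fsmap S X) (y : Y) : S :=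
  \sum_(x \in [set x : {classic X} | f x = y]) p x.
Definition ms_eta_fun X (x : X) (x' : X) : S := if `[< x' = x >] then 1 else 0.
Definition ms_mu_fun X (P : fsmap S (fsmap S X)) (x : X) : S :=
  \sum_(p \in [set: {classic fsmap S X}]) P p * (p : fsmap S X) x.

(* The pairing sum_x p(x) g(x); finitely supported maps are determined by it. *)
Definition integ X (p : fsmap S X) (g : X -> S) : S :=
  \sum_(x \in [set: {classic X}]) p x * g x.

Lemma integE X (p : fsmap S X) g (s : seq {classic X}) : uniq s ->
  (forall x, p x != 0 -> (x : {classic X}) \in s) ->
  integ p g = \sum_(x <- s) p x * g x.
Proof.
move=> us hs; rewrite /integ (fsbigE s) //.
  by apply: eq_bigl => x; rewrite in_setT.
move=> x _ xs; have [->|/hs] := eqVneq (p x) 0; first by rewrite mul0r.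
by rewrite (negbTE xs).
Qed.

Definition delta X (x x' : X) : S := ms_eta_fun x x'.

Lemma integ_delta_seq X (F : X -> S) (x : X) (s : seq {classic X}) : uniq s ->
  (F x != 0 -> (x : {classic X}) \in s) ->
  \sum_(x' <- s) F x' * delta x x' = F x.
Proof.
move=> us hs.
have hd (x' : {classic X}) : F x' * delta x x' = if x' == x then F x else 0.
  rewrite /delta /ms_eta_fun; case: eqP => [->|ne].
    by rewrite asboolT ?mulr1.
  by rewrite asboolF ?mulr0.
rewrite (eq_bigr _ (fun x' _ => hd x')) -big_mkcond /=.
have [xs|xs] := boolP ((x : {classic X}) \in s).
  rewrite -big_filter (perm_big [:: (x : {classic X})]) ?big_seq1 //.
  apply: uniq_perm => //; first exact: filter_uniq.
  move=> z; rewrite mem_filter inE.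
  by case: eqP => // ->.
rewrite big_seq_cond big_pred0; last first.
  by move=> z; apply/andP => -[zs /eqP zx]; rewrite zx (negbTE xs) in zs.
have [-> //|/hs] := eqVneq (F x) 0.
by rewrite (negbTE xs).
Qed.

Lemma integ_delta X (p : fsmap S X) x : integ p (delta x) = p x.
Proof.
by have [s us hs] := fs_enum p; rewrite (integE _ us hs) integ_delta_seq //; exact: hs.
Qed.

Lemma integ_ext X (p q : fsmap S X) : (forall g, integ p g = integ q g) -> p = q.
Proof. by move=> h; apply: fsmap_eq => x; rewrite -!integ_delta h. Qed.

Lemma ms_map_funE X Y (f : X -> Y) p y :
  ms_map_fun f p y = integ p (fun x => delta y (f x)).
Proof.
rewrite /ms_map_fun fsbig_mkcond /integ; apply: eq_fsbigr => x _.
rewrite /patch /delta /ms_eta_fun; case: asboolP => fx.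
  by rewrite mem_set // mulr1.
by rewrite memNset // mulr0.
Qed.

Lemma ms_map_fin X Y (f : X -> Y) p : finite_set [set y | ms_map_fun f p y != 0].
Proof.
have [s us hs] := fs_enum p.
apply: (@fs_finite _ _ _ (map (f : {classic X} -> {classic Y}) s)) => y.
apply: contraNT => ys; rewrite ms_map_funE (integE _ us hs) big_seq big1 // => x xs.
rewrite /delta /ms_eta_fun asboolF ?mulr0 // => fx.
by move/negP: ys; apply; rewrite -fx; apply: (map_f (f : {classic X} -> {classic Y})).
Qed.

Lemma ms_eta_fin X (x : X) : finite_set [set x' | ms_eta_fun x x' != 0].
Proof.
apply: (@fs_finite _ _ _ [:: (x : {classic X})]) => x'.
rewrite /ms_eta_fun; case: asboolP => [->|_]; last by rewrite eqxx.
by rewrite inE eqxx.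
Qed.

Lemma fs_enum_all X (s : seq {classic fsmap S X}) :
  exists2 t : seq {classic X}, uniq t &
    forall p : fsmap S X, (p : {classic fsmap S X}) \in s ->
    forall x, p x != 0 -> (x : {classic X}) \in t.
Proof.
elim: s => [|q s [t ut ht]]; first by exists [::].
have [r ur hr] := fs_enum q.
exists (undup (r ++ t)); first exact: undup_uniq.
move=> p; rewrite inE => /orP[/eqP->|ps] x px; rewrite mem_undup mem_cat.
  by rewrite hr.
by rewrite (ht _ ps _ px) orbT.
Qed.

Lemma ms_mu_fin X (P : fsmap S (fsmap S X)) : finite_set [set x | ms_mu_fun P x != 0].
Proof.
have [s us hs] := fs_enum P; have [t ut ht] := fs_enum_all s.
apply: (@fs_finite _ _ _ t) => x; apply: contraNT => xt.
rewrite -[ms_mu_fun P x]/(integ P (fun p => p x)) (integE _ us hs).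
rewrite big_seq big1 // => p ps.
have [->|px] := eqVneq ((p : fsmap S X) x) 0; first by rewrite mulr0.
by rewrite (ht _ ps _ px) in xt.
Qed.

Definition ms_map X Y (f : X -> Y) (p : fsmap S X) : fsmap S Y := FSMap (ms_map_fin f p).
Definition ms_eta X (x : X) : fsmap S X := FSMap (ms_eta_fin x).
Definition ms_mu X (P : fsmap S (fsmap S X)) : fsmap S X := FSMap (ms_mu_fin P).

Lemma eq_integ X (p : fsmap S X) g g' : g =1 g' -> integ p g = integ p g'.
Proof. by move=> /funext ->. Qed.

Lemma integ_map X Y (f : X -> Y) p g : integ (ms_map f p) g = integ p (g \o f).
Proof.
have [s us hs] := fs_enum p.
have [t ut ht] : exists2 t : seq {classic Y}, uniq t &
    forall x : {classic X}, x \in s -> (f x : {classic Y}) \in t.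
  exists (undup (map (f : {classic X} -> {classic Y}) s)); first exact: undup_uniq.
  by move=> x xs; rewrite mem_undup (map_f (f : {classic X} -> {classic Y})).
rewrite (integE _ ut); last first.
  move=> y; apply: contraNT => yt /=; rewrite ms_map_funE (integE _ us hs).
  rewrite big_seq big1 // => x xs; rewrite /delta /ms_eta_fun asboolF ?mulr0 // => fx.
  by rewrite -fx ht in yt.
rewrite (integE _ us hs) /=.
transitivity (\sum_(y <- t) \sum_(x <- s) p x * (g y * delta (f x) y)).
  apply: eq_bigr => y _; rewrite ms_map_funE (integE _ us hs) big_distrl /=.
  apply: eq_bigr => x _; rewrite -!mulrA; congr (_ * _); rewrite mulrC.
  congr (_ * _); rewrite /delta /ms_eta_fun.
  by congr (if _ then _ else _); apply/asbool_equiv_eq; split=> ->.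
rewrite exchange_big /= big_seq [RHS]big_seq; apply: eq_bigr => x xs.
by rewrite -big_distrr /= integ_delta_seq // => _; exact: ht.
Qed.

Lemma integ_eta X (x : X) g : integ (ms_eta x) g = g x.
Proof.
rewrite (@integE _ _ _ [:: (x : {classic X})]) //.
  by rewrite big_seq1 /= /ms_eta_fun asboolT // mul1r.
move=> x' /=; rewrite /ms_eta_fun; case: asboolP => [->|_]; last by rewrite eqxx.
by rewrite inE eqxx.
Qed.

Lemma integ_mu X (P : fsmap S (fsmap S X)) g :
  integ (ms_mu P) g = integ P (fun p => integ p g).
Proof.
have [s us hs] := fs_enum P; have [t ut ht] := fs_enum_all s.
have muE x : ms_mu P x = \sum_(p <- s) P p * (p : fsmap S X) x.
  by rewrite -(integE _ us hs).
rewrite (integE _ ut); last first.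
  move=> x; apply: contraNT => xt; rewrite muE big_seq big1 // => p ps.
  have [->|px] := eqVneq ((p : fsmap S X) x) 0; first by rewrite mulr0.
  by rewrite (ht _ ps _ px) in xt.
rewrite (integE _ us hs).
transitivity (\sum_(x <- t) \sum_(p <- s) P p * ((p : fsmap S X) x * g x)).
  apply: eq_bigr => x _; rewrite muE big_distrl /=.
  by apply: eq_bigr => p _; rewrite mulrA.
rewrite exchange_big /= big_seq [RHS]big_seq; apply: eq_bigr => p ps.
by rewrite -big_distrr /= (integE _ ut (ht _ ps)).
Qed.

Lemma integ_exchange X Y (p : fsmap S X) (q : fsmap S Y) (g : X -> Y -> S) :
  integ p (fun x => integ q (g x)) = integ q (fun y => integ p (g^~ y)).
Proof.
have [s us hs] := fs_enum p; have [t ut ht] := fs_enum q.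
rewrite (integE _ us hs) (integE _ ut ht).
transitivity (\sum_(x <- s) \sum_(y <- t) q y * (p x * g x y)).
  apply: eq_bigr => x _; rewrite (integE _ ut ht) big_distrr /=.
  by apply: eq_bigr => y _; rewrite mulrCA.
rewrite exchange_big; apply: eq_bigr => y _ /=.
by rewrite (integE _ us hs) big_distrr.
Qed.

Lemma integ0 X (p : fsmap S X) : integ p (fun=> 0) = 0.
Proof.
by have [s us hs] := fs_enum p; rewrite (integE _ us hs) big1 // => x _; rewrite mulr0.
Qed.

Definition msmonad : monad.
refine (@Monad (fsmap S) ms_map ms_eta ms_mu _ _ _ _ _ _ _).
- by move=> X u; apply: integ_ext => g; rewrite integ_map.
- by move=> X Y Z g f u; apply: integ_ext => k; rewrite !integ_map.
- by move=> X Y f x; apply: integ_ext => g; rewrite integ_map !integ_eta.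
- move=> X Y f u; apply: integ_ext => g; rewrite integ_map !integ_mu integ_map.
  by apply: eq_integ => p /=; rewrite integ_map.
- by move=> X u; apply: integ_ext => g; rewrite integ_mu integ_eta.
- move=> X u; apply: integ_ext => g; rewrite integ_mu integ_map.
  by apply: eq_integ => x /=; rewrite integ_eta.
- move=> X u; apply: integ_ext => g; rewrite !integ_mu integ_map.
  by apply: eq_integ => p /=; rewrite integ_mu.
Defined.

Lemma msmonad_commutative : commutative_monad msmonad.
Proof.
move=> X Y [p q]; apply: integ_ext => g; rewrite /st' /st /swap /=.
rewrite !integ_mu !integ_map.
transitivity (integ p (fun x => integ q (fun y => g (x, y)))).
  by apply: eq_integ => x /=; rewrite !integ_map.
rewrite integ_exchange; apply: eq_integ => x /=.
by rewrite integ_map.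
Qed.

Lemma msvoid_eq (p q : fsmap S void) : p = q.
Proof. by apply: fsmap_eq; case. Qed.

Lemma msmonad_affine0 : affine0 msmonad.
Proof.
have fin : finite_set [set x : void | (fun=> 0 : S) x != 0].
  by apply: (@fs_finite _ _ _ [::]); case.
exists (fun=> FSMap fin) => [p|[] //]; exact: msvoid_eq.
Qed.

Lemma ms_zero_integ (h : affine0 msmonad) X Y (x : X) g :
  integ (zero_map h Y x) g = 0.
Proof.
rewrite integ_map -[RHS](integ0 (bij_inv h tt)); apply: eq_integ; case.
Qed.

Lemma ms_bc (h : affine0 msmonad) X Y (u : fsmap S (X + Y)%type) :
  (forall x, (bc h u).1 x = u (inl x)) /\ (forall y, (bc h u).2 y = u (inr y)).
Proof.
split=> z; rewrite -integ_delta integ_mu integ_map -[RHS]integ_delta;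
  apply: eq_integ => -[x|x] /=; rewrite ?ms_zero_integ ?integ_eta //;
  rewrite /delta /ms_eta_fun.
- by congr (if _ then _ else _); apply/asbool_equiv_eq; split=> [->|[->]].
- by rewrite asboolF //; exact: (ms_zero_integ h x).
- by rewrite asboolF //; exact: (ms_zero_integ h x).
- by congr (if _ then _ else _); apply/asbool_equiv_eq; split=> [->|[->]].
Qed.

Lemma ms_pair_fin X Y (p : fsmap S X) (q : fsmap S Y) :
  finite_set [set z : X + Y | match z with inl x => p x | inr y => q y end != 0].
Proof.
have [s us hs] := fs_enum p; have [t ut ht] := fs_enum q.
apply: (@fs_finite _ _ _ (map (inl : {classic X} -> {classic X + Y}) s ++
  map (inr : {classic Y} -> {classic X + Y}) t)) => -[x /hs|y /ht] h;
  rewrite mem_cat.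
  by rewrite (map_f (inl : {classic X} -> {classic X + Y})).
by rewrite (map_f (inr : {classic Y} -> {classic X + Y})) ?orbT.
Qed.

Lemma msmonad_additive : additive_monad msmonad.
Proof.
exists msmonad_affine0 => X Y.
exists (fun pq => FSMap (ms_pair_fin pq.1 pq.2)) => [u|[p q]].
  have [h1 h2] := ms_bc msmonad_affine0 u.
  by apply: fsmap_eq => -[x|y] /=; rewrite -?h1 -?h2.
set u := FSMap _; have [h1 h2] := ms_bc msmonad_affine0 u.
rewrite [LHS]surjective_pairing.
by congr pair; apply: fsmap_eq => z; rewrite ?h1 ?h2.
Qed.

Definition msacmnd : acmnd := ACMnd msmonad_additive msmonad_commutative.
End Multiset.

Section MultisetMap.
Variables (S S' : comPzSemiRingType) (f : S -> S').

Lemma ms_scalar_fin (f0 : f 0 = 0) X (p : fsmap S X) :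
  finite_set [set x | f (p x) != 0].
Proof.
apply: sub_finite_set (fs_fin p) => x /=; apply: contraNN => /eqP ->.
by rewrite f0.
Qed.

(* Only f 0 = 0 is needed, so that this covers semiring maps as well as the
   involution of an involutive semiring seen as a plain function. *)
Definition ms_scalar (f0 : f 0 = 0) X (p : fsmap S X) : fsmap S' X :=
  FSMap (ms_scalar_fin f0 p).
End MultisetMap.

Section MultisetMorphism.
Variables (S S' : comPzSemiRingType) (f : {rmorphism S -> S'}).
Let F := ms_scalar (rmorph0 f).

Lemma integ_scalar X (p : fsmap S X) g : integ (F p) (f \o g) = f (integ p g).
Proof.
have [s us hs] := fs_enum p.
rewrite (integE _ us hs) (integE _ us); last first.
  by move=> x fx; apply: hs; apply: contraNN fx => /= /eqP ->; rewrite rmorph0.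
by rewrite rmorph_sum; apply: eq_bigr => x _; rewrite rmorphM.
Qed.

Lemma delta_scalar X (x : X) : delta S' x = f \o delta S x.
Proof.
apply/funext => x' /=; rewrite /delta /ms_eta_fun.
by case: asboolP => _; rewrite ?rmorph1 ?rmorph0.
Qed.

Lemma ms_scalar_nat X Y (g : X -> Y) (p : fsmap S X) :
  F (ms_map g p) = ms_map g (F p).
Proof.
apply: fsmap_eq => y /=; rewrite !ms_map_funE -integ_scalar.
by apply: eq_integ => x; rewrite delta_scalar.
Qed.

Lemma ms_scalar_prop : is_monad_map (T := msmonad S) (T' := msmonad S') (fun X => @F X).
Proof.
split=> [X Y g p|X x|X P] /=; first exact: ms_scalar_nat.
- by apply: fsmap_eq => z; exact/esym/(congr1 (@^~ z) (delta_scalar x)).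
- apply: fsmap_eq => z; rewrite ms_scalar_nat /=.
  rewrite -[RHS]/(integ _ (fun p : fsmap S' X => p z)) integ_map.
  by rewrite -[ms_mu_fun P z]/(integ P (fun p : fsmap S X => p z)) -integ_scalar.
Qed.

Definition ms_monad_map : monad_map (msmonad S) (msmonad S') := MonadMap ms_scalar_prop.
End MultisetMorphism.

Definition M0 : functor CSRNG ACMND.
refine (@Functor CSRNG ACMND msacmnd (fun S S' f => ms_monad_map f) _ _).
- by move=> S; apply: monad_map_eq => X p; exact: fsmap_eq.
- by move=> S1 S2 S3 g f; apply: monad_map_eq => X p; exact: fsmap_eq.
Defined.

Record is_involution (S : comPzSemiRingType) (star : S -> S) : Prop := {
  starD : forall s t, star (s + t) = star s + star t;
  star0 : star 0 = 0;
  starM : forall s t, star (s * t) = star s * star t;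
  star1 : star 1 = 1;
  starK : forall s, star (star s) = s }.

Record icsrng := ICSRng {
  ics_ring :> comPzSemiRingType;
  star : ics_ring -> ics_ring;
  ics_star : is_involution star }.

Record icsrng_map (S S' : icsrng) := ICSRngMap {
  icm_map :> {rmorphism S -> S'};
  icm_star : forall s, icm_map (star s) = star (icm_map s) }.

Lemma icsrng_map_eq (S S' : icsrng) (f g : icsrng_map S S') :
  icm_map f = icm_map g -> f = g.
Proof.
case: f g => f pf [g pg] /= fg; subst g; congr ICSRngMap; exact: Prop_irrelevance.
Qed.

Definition icsrng_id (S : icsrng) : icsrng_map S S :=
  @ICSRngMap S S (@idm CSRNG S) (fun=> erefl).

Lemma icsrng_comp_star (S1 S2 S3 : icsrng) (g : icsrng_map S2 S3) (f : icsrng_map S1 S2) s :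
  g (f (star s)) = star (g (f s)).
Proof. by rewrite !icm_star. Qed.

Definition icsrng_comp (S1 S2 S3 : icsrng) (g : icsrng_map S2 S3)
  (f : icsrng_map S1 S2) : icsrng_map S1 S3 :=
  @ICSRngMap S1 S3 (@cmp CSRNG _ _ _ (icm_map g) (icm_map f)) (icsrng_comp_star g f).

Definition ICSRNG : category.
refine (@Category icsrng icsrng_map icsrng_id icsrng_comp _ _ _).
- by move=> S S' f; apply: icsrng_map_eq; exact: (@cmp1m CSRNG).
- by move=> S S' f; apply: icsrng_map_eq; exact: (@cmpm1 CSRNG).
- by move=> S1 S2 S3 S4 h g f; apply: icsrng_map_eq; exact: (@cmpA CSRNG).
Defined.

Definition forget_ics : functor ICSRNG CSRNG :=
  @Functor ICSRNG CSRNG ics_ring (fun S S' f => icm_map f)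
    (fun=> erefl) (fun _ _ _ _ _ => erefl).

Record is_monad_involution (T : monad) (zeta : forall X, T X -> T X) : Prop := {
  zeta_map : is_monad_map zeta;
  zetaK : forall X (u : T X), zeta X (zeta X u) = u }.

Record iacmnd := IACMnd {
  iac_monad :> acmnd;
  zeta : forall X, iac_monad X -> iac_monad X;
  iac_zeta : is_monad_involution zeta }.

Arguments zeta T {X} u : rename.

Record iacmnd_map (T T' : iacmnd) := IACMndMap {
  iam_map :> monad_map T T';
  iam_zeta : forall X (u : T X), iam_map X (zeta T u) = zeta T' (iam_map X u) }.

Lemma iacmnd_map_eq (T T' : iacmnd) (s t : iacmnd_map T T') :
  iam_map s = iam_map t -> s = t.
Proof.
case: s t => s ps [t pt] /= st; subst t; congr IACMndMap; exact: Prop_irrelevance.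
Qed.

Definition iacmnd_id (T : iacmnd) : iacmnd_map T T :=
  @IACMndMap T T (mm_id T) (fun _ _ => erefl).

Lemma iacmnd_comp_zeta (T1 T2 T3 : iacmnd) (t : iacmnd_map T2 T3) (s : iacmnd_map T1 T2)
  X (u : T1 X) : t X (s X (zeta T1 u)) = zeta T3 (t X (s X u)).
Proof. by rewrite !iam_zeta. Qed.

Definition iacmnd_comp (T1 T2 T3 : iacmnd) (t : iacmnd_map T2 T3)
  (s : iacmnd_map T1 T2) : iacmnd_map T1 T3 :=
  @IACMndMap T1 T3 (mm_comp t s) (iacmnd_comp_zeta t s).

Definition IACMND : category.
refine (@Category iacmnd iacmnd_map iacmnd_id iacmnd_comp _ _ _).
- by move=> T T' s; apply: iacmnd_map_eq; exact: (@cmp1m ACMND).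
- by move=> T T' s; apply: iacmnd_map_eq; exact: (@cmpm1 ACMND).
- by move=> T1 T2 T3 T4 u t s; apply: iacmnd_map_eq; exact: (@cmpA ACMND).
Defined.

Definition forget_iac : functor IACMND ACMND :=
  @Functor IACMND ACMND iac_monad (fun T T' s => iam_map s)
    (fun=> erefl) (fun _ _ _ _ _ => erefl).

Definition ms_zeta (S : icsrng) (X : Type) : msmonad S X -> msmonad S X :=
  @ms_scalar S S (@star S) (star0 (ics_star S)) X.

Definition scal_star (T : iacmnd) : scal T -> scal T := @zeta T unit.

Arguments ms_zeta S X p : clear implicits.
Arguments scal_star T u : clear implicits.

(* Main.v *)
(* For an additive monad T every T(X) is a semimodule over the semiring T(1),
   and monad maps are semilinear.  In M_S(X) every element is the finite sum of
   the p(x) *: eta(x), so a monad map out of M_S is determined by its component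
   at 1; conversely a semiring map g : S -> T(1) extends semilinearly to
   p |-> sum_x g(p(x)) *: eta(x), which is a monad map.  This gives the adjunction
   without involutions.  For an involution-preserving g, the composites of its
   extension with the two zetas have the same transpose, hence agree. *)
From HB Require Import structures.
From mathcomp Require Import all_boot all_order all_algebra.
From mathcomp Require Import boolp classical_sets functions cardinality fsbigop.
Require Import Defs.
Set Implicit Arguments.
Unset Strict Implicit.
Unset Printing Implicit Defensive.
Import GRing.Theory.
Local Open Scope ring_scope.

(** By proof irrelevance the laws do not matter, so two functors are equal once their object and
    arrow parts agree by conversion. *)
Lemma functor_eq (C D : category) (o : C -> D)
  (arr : forall a b : C, hom a b -> hom (o a) (o b)) i i' c c' :
  @Functor C D o arr i c = @Functor C D o arr i' c'.
Proof. by congr Functor; exact: Prop_irrelevance. Qed.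

(** * Semimodule structure of T(X) over T(1) *)

Lemma bind_addr (T : monad) (a : additive_monad T) X Y (k l : X -> T Y) u :
  bind (fun x => addT a (k x) (l x)) u = addT a (bind k u) (bind l u).
Proof.
(* [W x] is the preimage of [(k x, l x)] under [bc]; binding [W] along [u] yields the preimage of
   the pair of binds. *)
pose W x := bij_inv (add_bc a Y Y) (k x, l x).
have eW x : bc (add_affine0 a) (W x) = (k x, l x) by rewrite bij_invKV.
rewrite (@addTE _ _ _ (bind W u)) ?fmap_bind //.
by rewrite bcE !bindA; congr pair; apply: eq_bind => x;
  move: (eW x); rewrite bcE => -[].
Qed.

(** An alias that carries the semimodule instances, as [scal] carries those of the semiring. *)
Definition tmod (T : acmnd) (X : Type) : Type := T X.
HB.instance Definition _ (T : acmnd) X := gen_eqMixin (tmod T X).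
HB.instance Definition _ (T : acmnd) X := gen_choiceMixin (tmod T X).

Section TModule.
Variables (T : acmnd) (X : Type).
Let a := acm_additive T.
Let addM : tmod T X -> tmod T X -> tmod T X := addT a (X := X).
Let zeroM : tmod T X := zeroT a X.
(** This is [mul1] with its second argument moved from T(1) to an arbitrary T(X). *)
Definition scaleT (c : scal T) (u : tmod T X) : tmod T X := bind (fun=> u) c.

Lemma tmod_addA : associative addM. Proof. exact: addTA. Qed.
Lemma tmod_addC : commutative addM. Proof. exact: addTC. Qed.
Lemma tmod_add0 : left_id zeroM addM.
Proof. by move=> u; rewrite tmod_addC; exact: addT0. Qed.

HB.instance Definition _ := GRing.isNmodule.Build (tmod T X)
  tmod_addA tmod_addC tmod_add0.

Lemma scaleTA c d u : scaleT c (scaleT d u) = scaleT (c * d) u.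
Proof. by rewrite /scaleT -[c * d]/(mul1 c d) mul1E bindA. Qed.
Lemma scale0T u : scaleT 0 u = 0.
Proof. exact: bind_zero. Qed.
Lemma scale1T : left_id 1 scaleT.
Proof. by move=> u; exact: bind_eta. Qed.
Lemma scaleTDr : right_distributive scaleT +%R.
Proof. by move=> c u v; exact: bind_addr. Qed.
Lemma scaleTDl u : {morph scaleT^~ u : c d / c + d}.
Proof. by move=> c d; exact: bind_add. Qed.

HB.instance Definition _ := GRing.Nmodule_isLSemiModule.Build (scal T) (tmod T X)
  scaleTA scale0T scale1T scaleTDr scaleTDl.
End TModule.

Lemma mm_scale (T T' : acmnd) (s : monad_map T T') X (c : scal T) (u : tmod T X) :
  s X (c *: u : tmod T X) = (scal_map s c) *: (s X u : tmod T' X) :> tmod T' X.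
Proof. exact: mm_bind. Qed.

Lemma mm_nmod (T T' : acmnd) (s : monad_map T T') X :
  nmod_morphism (s X : tmod T X -> tmod T' X).
Proof. by split=> [|u v]; [exact: mm_zeroT | exact: mm_addT]. Qed.

(** * Pointwise operations on finitely supported maps *)

Section MultisetModule.
Variable S : comPzSemiRingType.
Let MS := msacmnd S.

Lemma integ_unit (p : fsmap S unit) g : integ p g = p tt * g tt.
Proof.
rewrite (@integE _ _ _ _ [:: (tt : {classic unit})]) ?big_seq1 //.
by case; rewrite inE.
Qed.

Lemma integ_bind X Y (k : X -> fsmap S Y) p g :
  integ (bind (T := MS) k p) g = integ p (fun x => integ (k x) g).
Proof. by rewrite integ_mu integ_map. Qed.

Lemma integDr X (p : fsmap S X) g h :
  integ p (fun x => g x + h x) = integ p g + integ p h.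
Proof.
have [s us hs] := fs_enum p; rewrite !(integE _ us hs) -big_split /=.
by apply: eq_bigr => x _; rewrite mulrDr.
Qed.

(** A preimage [w] of [(p, q)] under [bc] turns all three integrals into integrals over [w]; on each
    injection one of the two projections is zero. *)
Lemma integ_add X (p q : tmod MS X) g :
  integ (p + q : tmod MS X) g = integ p g + integ q g.
Proof.
have [w ew] := bc_ex (acm_additive MS) p q.
have -> : p + q = fmap MS (@codiag X) w by exact: addTE.
move: ew; rewrite bcE => -[<- <-]; rewrite !integ_bind integ_map -integDr.
by apply: eq_integ => -[x|x] /=; rewrite integ_eta (ms_zero_integ _ x) ?addr0 ?add0r.
Qed.

Lemma integ_zero X g : integ (0 : tmod MS X) g = 0.
Proof. exact: ms_zero_integ. Qed.

Lemma integ_scale X (c : scal MS) (p : tmod MS X) g :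
  integ (c *: p : tmod MS X) g = (c : fsmap S unit) tt * integ p g.
Proof. by rewrite integ_bind integ_unit. Qed.

Lemma ms_addE X (p q : tmod MS X) x :
  ((p + q : tmod MS X) : fsmap S X) x = (p : fsmap S X) x + (q : fsmap S X) x.
Proof. by rewrite -!integ_delta integ_add. Qed.

Lemma ms_zeroE X x : ((0 : tmod MS X) : fsmap S X) x = 0.
Proof. by rewrite -integ_delta integ_zero. Qed.

Lemma ms_scaleE X (c : scal MS) (p : tmod MS X) x :
  ((c *: p : tmod MS X) : fsmap S X) x = (c : fsmap S unit) tt * (p : fsmap S X) x.
Proof. by rewrite -integ_delta integ_scale integ_delta. Qed.

Lemma scal_of_fin (c : S) : finite_set [set x : unit | (fun=> c) x != 0]%classic.
Proof. by apply: (@fs_finite _ _ _ [:: tt]); case; rewrite inE. Qed.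

(** The unit of the adjunction, identifying S with M_S(1). *)
Definition scal_of (c : S) : scal MS := FSMap (scal_of_fin c).

Lemma scal_of_nmod : nmod_morphism scal_of.
Proof.
split=> [|c d]; apply: fsmap_eq => -[] /=; first by symmetry; exact: (ms_zeroE tt).
by symmetry; exact: (@ms_addE unit (scal_of c) (scal_of d) tt).
Qed.

Lemma scal_of_monoid : monoid_morphism scal_of.
Proof.
split=> [|c d]; apply: fsmap_eq => -[] /=.
  by rewrite /ms_eta_fun asboolT.
rewrite -[RHS]/((mul1 (scal_of c : MS unit) (scal_of d) : fsmap S unit) tt) mul1E.
by symmetry; exact: (@ms_scaleE unit (scal_of c) (scal_of d) tt).
Qed.

HB.instance Definition _ := GRing.isNmodMorphism.Build S (scal MS) scal_of scal_of_nmod.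
HB.instance Definition _ := GRing.isMonoidMorphism.Build S (scal MS) scal_of scal_of_monoid.

(** Finitely supported maps are separated by [integ], which is additive and sends the term at [x] to
    [p x * g x]. *)
Lemma fsmap_sum X (p : tmod MS X) (s : seq {classic X}) : uniq s ->
  (forall x, (p : fsmap S X) x != 0 -> (x : {classic X}) \in s) ->
  p = \sum_(x <- s) scal_of ((p : fsmap S X) x) *: (ms_eta S x : tmod MS X).
Proof.
move=> us hs; apply: integ_ext => g; rewrite (integE _ us hs).
rewrite (big_morph (fun q : tmod MS X => integ q g) (id1 := 0) (op1 := +%R)).
- by apply: eq_bigr => x _; rewrite integ_scale integ_eta.
- by move=> q r; exact: integ_add.
- exact: integ_zero.
Qed.
End MultisetModule.

(** * Semilinear extension of a semiring map to a monad map *)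

Section Extension.
Variables (S : comPzSemiRingType) (T : acmnd) (g : {rmorphism S -> scal T}).
Let MS := msacmnd S.

Definition extend X (p : tmod MS X) : tmod T X :=
  \sum_(x \in [set: {classic X}]%classic)
    g ((p : fsmap S X) x) *: (eta T (x : X) : tmod T X).

(** Points outside the support contribute zero since [g] preserves 0, so several maps can be
    expanded over one common list. *)
Lemma extendE X (p : tmod MS X) (s : seq {classic X}) : uniq s ->
  (forall x, (p : fsmap S X) x != 0 -> (x : {classic X}) \in s) ->
  extend p = \sum_(x <- s) g ((p : fsmap S X) x) *: (eta T (x : X) : tmod T X).
Proof.
move=> us hs; rewrite /extend (fsbigE s) //.
  by apply: eq_bigl => x; rewrite in_setT.
move=> x _ xs; have [->|/hs] := eqVneq ((p : fsmap S X) x) 0.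
  by rewrite rmorph0 scale0r.
by rewrite (negbTE xs).
Qed.

Lemma extend0 X : extend (0 : tmod MS X) = 0.
Proof.
rewrite (@extendE _ _ [::]) ?big_nil // => x.
by rewrite ms_zeroE eqxx.
Qed.

Lemma extendD X : {morph @extend X : p q / p + q}.
Proof.
move=> p q; have [s us hs] := fs_enum p; have [t ut ht] := fs_enum q.
(* This list covers the supports of [p], [q] and [p + q] at once. *)
have ur := undup_uniq (s ++ t).
have hr (f : X -> S) :
    (forall x, f x != 0 -> (x : {classic X}) \in s \/ (x : {classic X}) \in t) ->
    forall x, f x != 0 -> (x : {classic X}) \in undup (s ++ t).
  by move=> h x /h xst; rewrite mem_undup mem_cat; apply/orP.
rewrite !(extendE ur).
- by rewrite -big_split; apply: eq_bigr => x _; rewrite ms_addE rmorphD; exact: scalerDl.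
- by apply: hr => x /ht; right.
- by apply: hr => x /hs; left.
- apply: hr => x; rewrite ms_addE => pq.
  have [p0|/hs] := eqVneq ((p : fsmap S X) x) 0; last by left.
  by right; apply: ht; rewrite p0 add0r in pq.
Qed.

Lemma extendZ X c (p : tmod MS X) : extend (scal_of c *: p) = g c *: extend p.
Proof.
have [s us hs] := fs_enum p; rewrite !(extendE us) //; last first.
  by move=> x; rewrite ms_scaleE => cp; apply: hs; apply: contraNN cp => /eqP->;
    rewrite mulr0.
by rewrite scaler_sumr; apply: eq_bigr => x _; rewrite ms_scaleE rmorphM scalerA.
Qed.

Lemma extend_eta X (x : X) : extend (ms_eta S x) = eta T x.
Proof.
rewrite (@extendE _ _ [:: (x : {classic X})]) //.
  by rewrite big_seq1 /= /ms_eta_fun asboolT // rmorph1 scale1r.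
move=> x' /=; rewrite /ms_eta_fun; case: asboolP => [->|_]; last by rewrite eqxx.
by rewrite inE eqxx.
Qed.

(** By [fsmap_sum] the elements [ms_eta S x] generate M_S(X), with coefficients of the form
    [scal_of c]. *)
Lemma eq_semilinear X (V : lSemiModType (scal T)) (f h : tmod MS X -> V) :
  nmod_morphism f -> nmod_morphism h ->
  (forall c p, f (scal_of c *: p) = g c *: f p) ->
  (forall c p, h (scal_of c *: p) = g c *: h p) ->
  (forall x, f (ms_eta S x) = h (ms_eta S x)) -> f =1 h.
Proof.
move=> [f0 fD] [h0 hD] fZ hZ fh p; have [s us hs] := fs_enum p.
rewrite (fsmap_sum us hs) (big_morph f fD f0) (big_morph h hD h0).
by apply: eq_bigr => x _; rewrite fZ hZ fh.
Qed.

(** Both sides are semilinear in [p] along [g] and agree on units by the monad laws. Naturality and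
    compatibility with [mu] both follow from it. *)
Lemma extend_bind X Y (k : X -> tmod MS Y) (p : tmod MS X) :
  extend (bind k p : tmod MS Y) = bind (fun x => extend (k x)) (extend p).
Proof.
apply: (@eq_semilinear _ _ (fun p => extend (bind k p))
  (fun p => bind (fun x => extend (k x)) (extend p))) => [| |c q|c q|x].
- split=> [|q r]; first by rewrite -[RHS]extend0; congr extend; exact: bind_zero.
  by rewrite -[RHS]extendD; congr extend; exact: bind_add.
- split=> [|q r]; first by rewrite extend0; exact: bind_zero.
  by rewrite extendD; exact: bind_add.
- by rewrite -extendZ; congr extend; exact: bindA.
- by rewrite extendZ; exact: bindA.
- rewrite extend_eta bind_eta; congr extend; exact: (bind_eta (T := MS)).
Qed.

Lemma extend_prop : is_monad_map (T := MS) (T' := T) extend.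
Proof.
split=> [X Y f p|X x|X P].
- rewrite [in LHS]fmapE extend_bind [RHS]fmapE; apply: eq_bind => x.
  exact: extend_eta.
- exact: extend_eta.
- have muE (T0 : monad) Y (u : T0 (T0 Y)) : mu T0 u = bind id u.
    by rewrite /bind fmap_id.
  rewrite !muE extend_bind [in RHS]fmapE extend_bind bindA.
  by apply: eq_bind => p; rewrite extend_eta bind_eta.
Qed.

Definition extend_map : monad_map MS T := MonadMap extend_prop.

Lemma extend_scal (c : S) : extend_map unit (scal_of c) = g c.
Proof.
rewrite /= (@extendE _ _ [:: (tt : {classic unit})]) //; last by case; rewrite inE.
(* On T(1) the scalar action is the multiplication, and [eta T tt] is its unit. *)
by rewrite big_seq1 -[RHS]mulr1; symmetry; exact: mul1E.
Qed.
End Extension.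

(** * The hom-set bijection without involutions *)

Definition transpose (S : comPzSemiRingType) (T : acmnd)
    (s : monad_map (msacmnd S) T) : {rmorphism S -> scal T} :=
  [the {rmorphism S -> scal T} of scal_map s \o @scal_of S].

Lemma transpose_extend (S : comPzSemiRingType) (T : acmnd) :
  cancel (@extend_map S T) (@transpose S T).
Proof. by move=> g; apply: rmorph_eq => c; exact: extend_scal. Qed.

(** A monad map [s] is semilinear along [transpose s] and preserves units, which determines it. *)
Lemma extend_transpose (S : comPzSemiRingType) (T : acmnd) :
  cancel (@transpose S T) (@extend_map S T).
Proof.
move=> s; apply: monad_map_eq => X p.
suff e : extend (transpose s) (X := X) =1 (s X : tmod (msacmnd S) X -> tmod T X).
  exact: e.
apply: (@eq_semilinear _ _ (transpose s)) => [| |c q|c q|x].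
- by split; [exact: extend0 | exact: extendD].
- exact: mm_nmod.
- exact: extendZ.
- exact: mm_scale.
- by rewrite extend_eta; symmetry; exact: (mm_eta (mm_prop s)).
Qed.

(** * Restriction of both functors to involutive objects *)

Section StarMorphism.
Variable S : icsrng.
Lemma star_nmod : nmod_morphism (@star S).
Proof. by case: (ics_star S) => *; split. Qed.
Lemma star_monoid : monoid_morphism (@star S).
Proof. by case: (ics_star S) => *; split. Qed.
HB.instance Definition _ := GRing.isNmodMorphism.Build S S (@star S) star_nmod.
HB.instance Definition _ := GRing.isMonoidMorphism.Build S S (@star S) star_monoid.
Definition star_rmorphism := [the {rmorphism S -> S} of @star S].

Lemma ms_zetaE X p : ms_zeta S X p = ms_monad_map star_rmorphism X p.
Proof. exact: fsmap_eq. Qed.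

(** An involution is a semiring endomorphism, and [ms_zeta] is the monad map that it induces. *)
Lemma ms_zeta_involution : is_monad_involution (ms_zeta S).
Proof.
split=> [|X p]; last by apply: fsmap_eq => x; exact: (starK (ics_star S)).
have -> : ms_zeta S = ms_monad_map star_rmorphism.
  by apply: functional_extensionality_dep => X; apply/funext => p; exact: ms_zetaE.
exact: mm_prop.
Qed.
End StarMorphism.

Definition ms_iacmnd (S : icsrng) : iacmnd :=
  @IACMnd (M0 S) (ms_zeta S) (ms_zeta_involution S).

Lemma ms_map_zeta (S S' : icsrng) (f : icsrng_map S S') X (p : msmonad S X) :
  ms_monad_map f X (ms_zeta S X p) = ms_zeta S' X (ms_monad_map f X p).
Proof. by apply: fsmap_eq => x; exact: icm_star. Qed.

Definition ms_functor : functor ICSRNG IACMND.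
refine (@Functor ICSRNG IACMND ms_iacmnd
  (fun S S' f => @IACMndMap (ms_iacmnd S) (ms_iacmnd S') (farr M0 (icm_map f))
    (@ms_map_zeta S S' f)) _ _).
- by move=> S; apply: iacmnd_map_eq; exact: (farr_id M0).
- by move=> S1 S2 S3 g f; apply: iacmnd_map_eq; exact: (farr_comp M0).
Defined.

Definition zeta_mm (T : iacmnd) : monad_map T T := MonadMap (zeta_map (iac_zeta T)).

(** As [zeta] is a monad map, its component at 1 is a semiring endomorphism. *)
Lemma scal_star_involution (T : iacmnd) : is_involution (scal_star T).
Proof.
split; last exact: (zetaK (iac_zeta T)).
- exact: (rmorphD (scal_map (zeta_mm T))).
- exact: (rmorph0 (scal_map (zeta_mm T))).
- exact: (rmorphM (scal_map (zeta_mm T))).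
- exact: (rmorph1 (scal_map (zeta_mm T))).
Qed.

Definition scal_icsrng (T : iacmnd) : icsrng :=
  @ICSRng (E0 T) (scal_star T) (scal_star_involution T).

Definition scal_functor : functor IACMND ICSRNG.
refine (@Functor IACMND ICSRNG scal_icsrng
  (fun T T' s => @ICSRngMap (scal_icsrng T) (scal_icsrng T') (farr E0 (iam_map s))
    (@iam_zeta _ _ s unit)) _ _).
- by move=> T; apply: icsrng_map_eq; exact: (farr_id E0).
- by move=> T1 T2 T3 t s; apply: icsrng_map_eq; exact: (farr_comp E0).
Defined.

Section Transpose.
Variables (S : icsrng) (T : iacmnd).

(** At 1, [ms_zeta] sends [scal_of c] to [scal_of (star c)], and [s] commutes with the two zetas. *)
Lemma transpose_star (s : iacmnd_map (ms_functor S) T) (c : S) :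
  transpose s (star c) = scal_star T (transpose s c).
Proof.
rewrite -[RHS](iam_zeta s (scal_of c)) /=; congr (s _ _); exact: fsmap_eq.
Qed.

Definition itranspose (s : iacmnd_map (ms_functor S) T) : icsrng_map S (scal_functor T) :=
  @ICSRngMap S (scal_functor T) (transpose s) (transpose_star s).

Lemma extend_zeta (g : icsrng_map S (scal_functor T)) X (p : msmonad S X) :
  extend_map (g : {rmorphism S -> scal T}) X (ms_zeta S X p) =
  zeta T (extend_map (g : {rmorphism S -> scal T}) X p).
Proof.
set r := extend_map _.
(* Both sides are monad maps out of M_S, so it suffices to compare their transposes. *)
suff e : mm_comp r (ms_monad_map (star_rmorphism S)) = mm_comp (zeta_mm T) r.
  by rewrite ms_zetaE; exact: (congr1 (fun s : monad_map _ _ => s X p) e).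
apply: (can_inj (@extend_transpose S T)); apply: rmorph_eq => c.
transitivity (r unit (scal_of (star c))); first by congr (r _ _); exact: fsmap_eq.
rewrite extend_scal (icm_star g) -(extend_scal g c) //.
Qed.

Definition iextend (g : icsrng_map S (scal_functor T)) : iacmnd_map (ms_functor S) T :=
  @IACMndMap (ms_functor S) T (extend_map (g : {rmorphism S -> scal T})) (extend_zeta g).

Lemma itranspose_bij : bijective itranspose.
Proof.
exists iextend => [s|g].
  by apply: iacmnd_map_eq; exact: extend_transpose.
by apply: icsrng_map_eq; exact: transpose_extend.
Qed.
End Transpose.

Theorem lemma31 :
  exists (M : functor ICSRNG IACMND) (E : functor IACMND ICSRNG),
    [/\ fcomp forget_iac M = fcomp M0 forget_ics /\
        (forall S : icsrng, exists h : is_monad_involution (ms_zeta S),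
           M S = @IACMnd (M0 S) (ms_zeta S) h),
        fcomp forget_ics E = fcomp E0 forget_iac /\
        (forall T : iacmnd, exists h : is_involution (scal_star T),
           E T = @ICSRng (E0 T) (scal_star T) h)
      & adjoint M E].
Proof.
exists ms_functor, scal_functor; split.
- split; first exact: functor_eq.
  by move=> S; exists (ms_zeta_involution S).
- split; first exact: functor_eq.
  by move=> T; exists (scal_star_involution T).
exists itranspose; split=> [S T|S' S T T' f g h]; first exact: itranspose_bij.
apply: icsrng_map_eq; apply: rmorph_eq => c /=.
(* What remains is naturality of the unit: M(f) sends [scal_of c] to [scal_of (f c)]. *)
congr (h _ (g _ _)); exact: fsmap_eq.
Qed.
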